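(* Let $\nu\ge1$ be an integer, $\alpha>0$, $\epsilon>0$, and let $\{\boldsymbol{X}^t\}_{t\ge0}$ be the iterates of the LOZO algorithm and $\{\tilde{\boldsymbol{X}}^{(k)}\},\{\boldsymbol{B}^{(k,s)}\}$ the iterates of the zeroth-order subspace method (both defined in the context), run with the same random draws, i.e. the same $\boldsymbol{V}^{(k)}$ for every $k$, and $\boldsymbol{U}^{(k,s)}=\boldsymbol{U}^{k\nu+s}$, $\xi^{(k,s)}=\xi^{k\nu+s}$ for all $k\ge0$, $0\le s\le\nu-1$. If the step sizes satisfy $\boldsymbol{\gamma}=\alpha/\boldsymbol{r}$ (i.e. $\gamma_\ell=\alpha/r_\ell$ for each layer $\ell$) and $\boldsymbol{X}^0=\tilde{\boldsymbol{X}}^{(0)}$, then for all $k\ge0$ and $s\in\{0,1,\dots,\nu\}$ $$\boldsymbol{X}^{k\nu+s}=\tilde{\boldsymbol{X}}^{(k)}+\boldsymbol{B}^{(k,s)}(\boldsymbol{V}^{(k)})^T,$$ and in particular $\boldsymbol{X}^{k\nu}=\tilde{\boldsymbol{X}}^{(k)}$ for every $k\ge0$.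
   Context: Variables are $\boldsymbol{X}=\{X_\ell\}_{\ell=1}^{\mathcal{L}}$ with $X_\ell\in\mathbb{R}^{m_\ell\times n_\ell}$; $F(\boldsymbol{X};\xi)$ is a real-valued loss depending on a sample $\xi$; $\boldsymbol{r}=\{r_\ell\}$ are positive integers. All operations on collections are layer-wise, e.g. $\boldsymbol{X}+\boldsymbol{B}\boldsymbol{V}^T=\{X_\ell+B_\ell V_\ell^T\}_\ell$ with $B_\ell\in\mathbb{R}^{m_\ell\times r_\ell}$, $V_\ell\in\mathbb{R}^{n_\ell\times r_\ell}$, and $\boldsymbol{U}\boldsymbol{V}^T/\boldsymbol{r}=\{U_\ell V_\ell^T/r_\ell\}_\ell$ with $U_\ell\in\mathbb{R}^{m_\ell\times r_\ell}$. LOZO algorithm: for $k\ge0$ and $t\in\{k\nu,\dots,(k+1)\nu-1\}$, $$\boldsymbol{X}^{t+1}=\boldsymbol{X}^t-\alpha\,\frac{F(\boldsymbol{X}^t+\epsilon\boldsymbol{U}^t(\boldsymbol{V}^{(k)})^T;\xi^t)-F(\boldsymbol{X}^t-\epsilon\boldsymbol{U}^t(\boldsymbol{V}^{(k)})^T;\xi^t)}{2\epsilon}\,\big(\boldsymbol{U}^t(\boldsymbol{V}^{(k)})^T/\boldsymbol{r}\big).$$ Zeroth-order subspace method with step sizes $\boldsymbol{\gamma}=\{\gamma_\ell\}$: for each $k\ge0$, set $\boldsymbol{B}^{(k,0)}=\boldsymbol{0}$ and for $s=0,\dots,\nu-1$ $$\boldsymbol{B}^{(k,s+1)}=\boldsymbol{B}^{(k,s)}-\boldsymbol{\gamma}\,c^{(k,s)}\,\boldsymbol{U}^{(k,s)},$$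 $$c^{(k,s)}=\frac{F(\tilde{\boldsymbol{X}}^{(k)}+(\boldsymbol{B}^{(k,s)}+\epsilon\boldsymbol{U}^{(k,s)})(\boldsymbol{V}^{(k)})^T;\xi^{(k,s)})-F(\tilde{\boldsymbol{X}}^{(k)}+(\boldsymbol{B}^{(k,s)}-\epsilon\boldsymbol{U}^{(k,s)})(\boldsymbol{V}^{(k)})^T;\xi^{(k,s)})}{2\epsilon},$$ where $\boldsymbol{\gamma}$ acts by multiplying layer $\ell$ by $\gamma_\ell$; then $\tilde{\boldsymbol{X}}^{(k+1)}=\tilde{\boldsymbol{X}}^{(k)}+\boldsymbol{B}^{(k,\nu)}(\boldsymbol{V}^{(k)})^T$. *)

(* Defs.v *)
From mathcomp Require Import all_boot all_order all_algebra.
From mathcomp Require Import reals.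

Set Implicit Arguments.
Unset Strict Implicit.
Unset Printing Implicit Defensive.

Import Order.TTheory GRing.Theory Num.Theory.
Local Open Scope ring_scope.

(* Collections of matrices indexed by the layers 'I_L; the shape of the matrix
   may vary with the layer, hence the dependent function type. *)
Definition layers (R : realType) (L : nat) (p q : 'I_L -> nat) : Type :=
  forall l : 'I_L, 'M[R]_(p l, q l).

Section LayerwiseOperations.
Variables (R : realType) (L : nat).
Implicit Types p q r : 'I_L -> nat.

Definition layers0 p q : layers R p q := fun l => 0.

Definition addL p q (X Y : layers R p q) : layers R p q := fun l => X l + Y l.

Definition subL p q (X Y : layers R p q) : layers R p q := fun l => X l - Y l.

Definition scaleL p q (a : R) (X : layers R p q) : layers R p q :=
  fun l => a *: X l.

(* One scalar per layer. *)
Definition lscaleL p q (g : 'I_L -> R) (X : layers R p q) : layers R p q :=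
  fun l => g l *: X l.

(* U V^T / r is [divL (mulTL U V) r]. *)
Definition divL p q (X : layers R p q) r : layers R p q :=
  fun l => (r l)%:R^-1 *: X l.

Definition mulTL p q r (U : layers R p r) (V : layers R q r) : layers R p q :=
  fun l => U l *m (V l)^T.

End LayerwiseOperations.

Arguments layers0 {R L p q}.

Section Methods.
Variables (R : realType) (L : nat) (m n r : 'I_L -> nat).
Variables (Xi : Type) (F : layers R m n -> Xi -> R) (nu : nat) (eps : R).

Definition lozo_coef (X : layers R m n) (U : layers R m r) (V : layers R n r)
    (xi : Xi) : R :=
  (F (addL X (scaleL eps (mulTL U V))) xi
   - F (subL X (scaleL eps (mulTL U V))) xi) / (2 * eps).

(* [U t], [V k] and [xi t] are the realized draws. *)
Definition lozo_iterates (alpha : R) (U : nat -> layers R m r)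
    (V : nat -> layers R n r) (xi : nat -> Xi) (X : nat -> layers R m n) : Prop :=
  forall k t : nat, (k * nu <= t < k.+1 * nu)%N ->
    X t.+1 =
    subL (X t) (scaleL (alpha * lozo_coef (X t) (U t) (V k) (xi t))
                       (divL (mulTL (U t) (V k)) r)).

Definition zo_subspace_coef (X : layers R m n) (B U : layers R m r)
    (V : layers R n r) (xi : Xi) : R :=
  (F (addL X (mulTL (addL B (scaleL eps U)) V)) xi
   - F (addL X (mulTL (subL B (scaleL eps U)) V)) xi) / (2 * eps).

(* [B k s] is constrained only for s <= nu; [U k s] and [xi k s] are used only
   for s < nu. *)
Definition zo_subspace_iterates (gamma : 'I_L -> R)
    (U : nat -> nat -> layers R m r) (V : nat -> layers R n r)
    (xi : nat -> nat -> Xi) (X : nat -> layers R m n)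
    (B : nat -> nat -> layers R m r) : Prop :=
  forall k : nat,
    [/\ B k 0%N = layers0,
        forall s : nat, (s < nu)%N ->
          B k s.+1 =
          subL (B k s)
            (lscaleL gamma
               (scaleL (zo_subspace_coef (X k) (B k s) (U k s) (V k) (xi k s))
                       (U k s)))
      & X k.+1 = addL (X k) (mulTL (B k nu) (V k))].

End Methods.

(* Main.v *)
Require Import Defs.
From mathcomp Require Import all_boot all_order all_algebra.
From mathcomp Require Import reals.
From Stdlib Require Import FunctionalExtensionality.

(** With [gamma = alpha / r], one subspace step changes [X' k + B V^T] by exactly
    the LOZO update at that point: moving [B] by [eps * U] moves [X' k + B V^T]
    by [eps * U V^T], so the two finite differences coincide.  Induction on [s]
    within a period and then on [k] across periods gives the equality. *)

Import Order.TTheory GRing.Theory Num.Theory.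
Local Open Scope ring_scope.

(** Since [F] is an arbitrary function of a whole collection, layerwise identities can be rewritten
    inside its argument only once they are equalities of dependent functions. *)
Lemma layersP (R : realType) (L : nat) (p q : 'I_L -> nat) (X Y : layers R p q) :
  (forall l, X l = Y l) -> X = Y.
Proof. exact: functional_extensionality_dep. Qed.

Section SubspaceStep.
Variables (R : realType) (L : nat) (m n r : 'I_L -> nat).
Implicit Types (X : layers R m n) (B U : layers R m r) (V : layers R n r).

Lemma addL_mulTL0 X V : addL X (mulTL (@layers0 R L m r) V) = X.
Proof. by apply: layersP => l; rewrite /addL /mulTL /layers0 mul0mx addr0. Qed.

Lemma addL_mulTL_add (a : R) X B U V :
  addL X (mulTL (addL B (scaleL a U)) V) =
  addL (addL X (mulTL B V)) (scaleL a (mulTL U V)).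
Proof.
by apply: layersP => l; rewrite /addL /mulTL /scaleL mulmxDl scalemxAl addrA.
Qed.

Lemma addL_mulTL_sub (a : R) X B U V :
  addL X (mulTL (subL B (scaleL a U)) V) =
  subL (addL X (mulTL B V)) (scaleL a (mulTL U V)).
Proof.
apply: layersP => l.
by rewrite /addL /subL /mulTL /scaleL mulmxBl scalemxAl addrA.
Qed.

Lemma zo_subspace_coefE (Xi : Type) (F : layers R m n -> Xi -> R) (eps : R)
    X B U V (x : Xi) :
  zo_subspace_coef F eps X B U V x =
  lozo_coef F eps (addL X (mulTL B V)) U V x.
Proof.
by rewrite /zo_subspace_coef /lozo_coef addL_mulTL_add addL_mulTL_sub.
Qed.

(** Right multiplication by [V^T] is linear and commutes with scalars, and [alpha / r * c] regroups
    as [alpha * c / r] in each layer. *)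
Lemma addL_mulTL_step (alpha : R) (gamma : 'I_L -> R) (c : R) X B U V :
  (forall l, gamma l = alpha / (r l)%:R) ->
  addL X (mulTL (subL B (lscaleL gamma (scaleL c U))) V) =
  subL (addL X (mulTL B V)) (scaleL (alpha * c) (divL (mulTL U V) r)).
Proof.
move=> gammaE; apply: layersP => l.
rewrite /addL /subL /mulTL /lscaleL /scaleL /divL gammaE mulmxBl addrA.
by rewrite !scalerA -scalemxAl mulrAC.
Qed.

End SubspaceStep.

Theorem mainTheorem2 (R : realType) (L : nat) (m n r : 'I_L -> nat)
    (r_gt0 : forall l, (0 < r l)%N)
    (Xi : Type) (F : layers R m n -> Xi -> R)
    (nu : nat) (nu_ge1 : (1 <= nu)%N)
    (alpha : R) (alpha_gt0 : 0 < alpha)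
    (eps : R) (eps_gt0 : 0 < eps)
    (gamma : 'I_L -> R)
    (* draws and iterates of LOZO *)
    (U : nat -> layers R m r) (V : nat -> layers R n r) (xi : nat -> Xi)
    (X : nat -> layers R m n)
    (hX : lozo_iterates F nu eps alpha U V xi X)
    (* draws and iterates of the subspace method *)
    (U' : nat -> nat -> layers R m r) (V' : nat -> layers R n r)
    (xi' : nat -> nat -> Xi)
    (X' : nat -> layers R m n) (B : nat -> nat -> layers R m r)
    (hX' : zo_subspace_iterates F nu eps gamma U' V' xi' X' B)
    (* same random draws *)
    (hV : forall k : nat, V' k = V k)
    (hU : forall k s : nat, (s < nu)%N -> U' k s = U (k * nu + s)%N)
    (hxi : forall k s : nat, (s < nu)%N -> xi' k s = xi (k * nu + s)%N)
    (hgamma : forall l, gamma l = alpha / (r l)%:R)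
    (hX0 : X 0%N = X' 0%N) :
  (forall k s : nat, (s <= nu)%N ->
     X (k * nu + s)%N = addL (X' k) (mulTL (B k s) (V k))) /\
  (forall k : nat, X (k * nu)%N = X' k).
Proof.
(* Agreement at the start of period [k] is kept as a premise, to be supplied later by the induction
   on [k]. *)
have period k : X (k * nu)%N = X' k -> forall s, (s <= nu)%N ->
    X (k * nu + s)%N = addL (X' k) (mulTL (B k s) (V k)).
  move=> Xk; have [B0 BS _] := hX' k.
  elim=> [_|s IHs s_lt]; first by rewrite addn0 B0 addL_mulTL0.
  (* Time [k * nu + s] lies in period [k] because [s < nu], so LOZO uses [V k] here. *)
  rewrite addnS (hX k); last by rewrite leq_addr mulSnr ltn_add2l.
  rewrite BS // (addL_mulTL_step _ _ _ _ _ alpha) // zo_subspace_coefE.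
  by rewrite hV hU // hxi // IHs // ltnW.
have start k : X (k * nu)%N = X' k.
  elim: k => [|k IHk]; first by rewrite mul0n.
  have [_ _ ->] := hX' k.
  (* The case [s = nu] of [period] is the start of period [k.+1]. *)
  by rewrite mulSnr hV period.
by split=> // k; apply: period.
Qed.
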